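(* Let $\{X_t\}_{t\ge 0}$ be a continuous-time Markov process on $\{0,1,2,\dots\}$ with generator $Q=((q_{ij}))_{0\le i,j<\infty}$ satisfying, for all $i\ge 0$, $q_{i,i+1}>0$, $q_{ij}=0$ if $j>i+1$, and $\sum_{j=0}^{i+1}q_{ij}=0$. Let $n\ge 1$, let $T_n$ be the first time the process reaches state $n$, let $l_{T_n}^i$ be the amount of time the process spends in state $i$ before it reaches $n$, and let $Q_n=((q_{ij}))_{0\le i,j\le n-1}$ be the upper $n\times n$ submatrix of $Q$. Then for all real numbers $d_i\ge 0$, $i=0,1,\dots,n-1$, $$\mathbf{E}_0\left[e^{-\sum_{i=0}^{n-1}d_i l_{T_n}^i}\right]=\frac{|-Q_n|}{|D-Q_n|},$$ where $D$ is the $n\times n$ diagonal matrix with diagonal entries $d_0,d_1,\dots,d_{n-1}$.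
   Context: A generator matrix $Q=((q_{ij}))$ has $q_{ij}\ge 0$ for $i\ne j$: from state $i$ the process waits an exponential time with rate $-q_{ii}$ and then jumps to $j\neq i$ with probability $q_{ij}/(-q_{ii})$. $|M|$ denotes the determinant of a square matrix $M$. $\mathbf{E}_0$ denotes expectation for the process started at state $0$. The occupation time is $l_{T_n}^i=\int_0^{T_n}1_{\{X_s=i\}}\,ds$. *)

(* Defs.v *)
From HB Require Import structures.
From mathcomp Require Import all_boot all_order all_algebra.
From mathcomp Require Import all_classical all_reals all_analysis.

Set Implicit Arguments.
Unset Strict Implicit.
Unset Printing Implicit Defensive.

Import Order.TTheory GRing.Theory Num.Theory.
Import numFieldNormedType.Exports.

Local Open Scope classical_set_scope.
Local Open Scope ring_scope.

(* Probability that a jump out of i leads to j. *)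
Definition jump_prob (R : realType) (Q : nat -> nat -> R) (i j : nat) : R :=
  if i == j then 0 else Q i j / - Q i i.

(* X is a continuous-time Markov process on nat with generator Q and arbitrary
   initial law, given by its jump chain Y and its holding times S: with
   Y 0, ..., Y m prescribed, the holding times S 0, ..., S (m - 1) are
   independent and exponential, S k having rate - Q (Y k) (Y k), and Y is a
   Markov chain with transition probabilities jump_prob Q.
   - The definition is meant for Q without absorbing states, i.e. Q i i < 0 for
     all i (exponential_prob is a probability only for positive rates).
   - Only times t >= 0 are meaningful; values of X at t < 0 are ignored.
   - Nothing is required of X after the explosion time sup_k (sum_(i < k) S i)
     except measurability, so non-explosion is not assumed. *)
Definition is_ctmc d (T : measurableType d) (R : realType)
    (P : probability T R) (Q : nat -> nat -> R) (X : R -> T -> nat) : Prop :=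
  (forall t, 0 <= t -> measurable_fun setT (X t)) /\
  exists (Y : nat -> {RV P >-> nat}) (S : nat -> {RV P >-> R}),
    (forall (m : nat) (y : nat -> nat) (B : nat -> set R),
        (forall k, measurable (B k)) ->
        P [set w | (forall k, (k <= m)%N -> Y k w = y k) /\
                   (forall k, (k < m)%N -> B k (S k w))] =
        (P [set w | Y 0%N w = y 0%N] *
         \prod_(k < m) (exponential_prob (- Q (y k) (y k)) (B k) *
                        (jump_prob Q (y k) (y k.+1))%:E))%E) /\
    {ae P, forall w, forall (k : nat) (t : R),
        \sum_(i < k) S i w <= t < \sum_(i < k.+1) S i w -> X t w = Y k w}.

(* First time the path w reaches state n, +oo if it never does. *)
Definition hitting_time (T : Type) (R : realType) (X : R -> T -> nat)
    (n : nat) (w : T) : \bar R :=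
  ereal_inf [set t%:E | t in [set t : R | 0 <= t /\ X t w = n]].

Definition occupation_time (T : Type) (R : realType) (X : R -> T -> nat)
    (i n : nat) (w : T) : \bar R :=
  (\int[lebesgue_measure]_(s in [set s : R | 0 <= s%:E <= hitting_time X n w])
    (\1_[set s : R | X s w = i] s)%:E)%E.

(* Main.v *)
(** Let [M i j = q_ij / (d_i - q_ii)] for [i <> j].  Independence of the holding
    times along a prescribed path gives the path [y_0, ..., y_m] of the jump
    chain the discounted weight [\prod_k M (y_k) (y_(k+1))].  Summing over paths
    that first reach [n] at their last step yields a series [u_i] satisfying
    [u = M u + M(-, n)], i.e. [(D - Qn) u = q_(n-1,n) e_(n-1)].  As [D - Qn] is
    lower Hessenberg with superdiagonal independent of [D], Cramer's rule gives
    [\det (D - Qn) * u_0 = \prod_i q_(i,i+1)].  For [D = 0] the constant vector 1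
    solves the same system because the rows of [Q] sum to zero, so the product
    is [\det (- Qn)]; the same computation with [d = 0] shows that the passage
    probabilities sum to 1, i.e. that [n] is reached almost surely. *)

Require Import Defs.
From HB Require Import structures.
From mathcomp Require Import all_boot all_order all_algebra.
From mathcomp Require Import all_classical all_reals all_analysis.
From mathcomp Require Import measurable_realfun simple_functions.
Import Order.TTheory GRing.Theory Num.Theory.
Import numFieldNormedType.Exports.
Local Open Scope classical_set_scope.
Local Open Scope ring_scope.

Set Implicit Arguments.
Unset Strict Implicit.
Unset Printing Implicit Defensive.

(** * Integrals *)

Section ge0_integral.
Import HBNNSimple.

Lemma ge0_le_integral_ae d (T : measurableType d) (R : realType)
    (mu : {measure set T -> \bar R}) (f g : T -> \bar R) :
  (forall x, 0 <= f x)%E -> (forall x, 0 <= g x)%E ->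
  {ae mu, forall x, f x <= g x}%E ->
  (\int[mu]_x f x <= \int[mu]_x g x)%E.
Proof.
move=> f0 g0 [N [mN muN fgN]].
rewrite !ge0_integralTE//; apply: ge_ereal_sup => _ [h /= hf <-].
(* Setting [h] to 0 on the null set [N] keeps its integral and puts it below [g] everywhere, as [g]
   is nonnegative. *)
pose h' : {nnsfun T >-> R} := proj_nnsfun h (measurableC mN).
have -> : sintegral mu h = sintegral mu h'.
  rewrite -!integralT_nnsfun; apply: ge0_ae_eq_integral => //.
  - by apply/measurable_EFinP; exact: measurable_funPT.
  - by apply/measurable_EFinP; exact: measurable_funPT.
  - by move=> x _; rewrite lee_fin.
  - by move=> x _; rewrite lee_fin.
  - exists N; split => // x /=; apply: contra_notP => Nx _.
    by rewrite /h' mindicE in_setC memNset ?mulr1.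
apply: ereal_sup_ubound; exists h' => //= x.
rewrite mindicE in_setC; have [xN|xN] := boolP (x \in N).
  by rewrite mulr0.
rewrite mulr1; apply: (le_trans (hf x)); apply: contrapT => fgx.
by move/negP : xN; apply; apply/mem_set/fgN.
Qed.

(* Neither function is assumed measurable: the integral of a nonnegative
   function is a supremum over simple functions below it, and these can be cut
   off on the exceptional null set. *)
Lemma ge0_eq_integral_ae d (T : measurableType d) (R : realType)
    (mu : {measure set T -> \bar R}) (f g : T -> \bar R) :
  (forall x, 0 <= f x)%E -> (forall x, 0 <= g x)%E ->
  {ae mu, forall x, f x = g x}%E ->
  (\int[mu]_x f x = \int[mu]_x g x)%E.
Proof.
move=> f0 g0 fg; apply/eqP; rewrite eq_le; apply/andP; split;
  apply: ge0_le_integral_ae => //; by apply: filterS fg => x /= ->.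
Qed.

(** The hypothesis on indicators says that [phi] carries the measure with density [H] to [c * nu].
    It extends to simple functions by linearity and to [f] by monotone convergence. With [phi = S j]
    this integrates out one holding time; with [phi = idfun] it passes to a density. *)
Lemma ge0_integral_image_measure d d' (T : measurableType d)
    (T' : measurableType d') (R : realType)
    (mu : {measure set T -> \bar R}) (nu : {measure set T' -> \bar R})
    (phi : T -> T') (H : T -> R) (c : R) (f : T' -> \bar R) :
  measurable_fun setT phi -> measurable_fun setT H -> (forall x, 0 <= H x) ->
  (forall B, measurable B ->
    \int[mu]_x ((H x)%:E * (\1_B (phi x))%:E) = c%:E * nu B)%E ->
  0 <= c ->
  measurable_fun setT f -> (forall y, 0 <= f y)%E ->
  (\int[mu]_x ((H x)%:E * f (phi x)) = c%:E * \int[nu]_y f y)%E.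
Proof.
move=> mphi mH H0 HB c0 mf f0.
pose h := nnsfun_approx measurableT mf.
have hf y : (EFin \o h n) y @[n --> \oo] --> f y.
  by apply: cvg_nnsfun_approx.
have mHE : measurable_fun setT (EFin \o H) by exact/measurable_EFinP.
have H0E x : (0 <= (H x)%:E)%E by rewrite lee_fin.
have ndh y a b : (a <= b)%N -> ((h a y)%:E <= (h b y)%:E)%E.
  by move=> ab; rewrite lee_fin; exact/lefP/nd_nnsfun_approx.
have mh n : measurable_fun setT (EFin \o h n).
  by apply/measurable_EFinP; exact: measurable_funPT.
have hn n : (\int[mu]_x ((H x)%:E * (h n (phi x))%:E) =
             c%:E * \int[nu]_y (h n y)%:E)%E.
  have m1 r : measurable_fun setT
      (fun y => (r * \1_(h n @^-1` [set r]) y)%:E : \bar R).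
    by apply/measurable_EFinP; exact: measurable_funM.
  have r0 r y : (0 <= (r * \1_(h n @^-1` [set r]) y)%:E)%E.
    exact: nnfun_muleindic_ge0.
  transitivity (\int[mu]_x (\sum_(r \in range (h n))
      (H x)%:E * (r * \1_(h n @^-1` [set r]) (phi x))%:E)%E)%E.
    apply: eq_integral => x _; rewrite fimfunE -fsumEFin//.
    rewrite !fsbig_finite//= ge0_sume_distrr//.
  rewrite ge0_integral_fsum//; last 2 first.
  - move=> r; apply: emeasurable_funM => //.
    by apply: (measurableT_comp (m1 r)).
  - by move=> r x _; rewrite mule_ge0.
  transitivity (c%:E * \int[nu]_y (\sum_(r \in range (h n))
      (r * \1_(h n @^-1` [set r]) y)%:E)%E)%E; last first.
    congr (_ * _)%E; apply: eq_integral => y _.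
    by rewrite [in RHS]fimfunE -fsumEFin.
  rewrite ge0_integral_fsum//.
  rewrite !fsbig_finite//= ge0_sume_distrr; last first.
    by move=> r _; apply: integral_ge0.
  apply: eq_bigr => r _.
  have mhr : measurable (h n @^-1` [set r]) by exact: measurable_funPTI.
  (* Pulling [r] out of the integral uses [0 <= r]; negative values have empty preimage under
     [h n]. *)
  have [r_ge0|r_lt0] := leP 0 r; last first.
    rewrite preimage_nnfun0// !integral0_eq ?mule0//.
    - by move=> y _; rewrite indic0 mulr0.
    - by move=> y _; rewrite indic0 mulr0 mule0.
  under eq_integral do rewrite EFinM muleCA.
  rewrite ge0_integralZl//; last 2 first.
  - apply: emeasurable_funM => //; apply/measurable_EFinP.
    by apply: (measurableT_comp _ mphi).
  - by move=> x _; rewrite mule_ge0// lee_fin.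
  rewrite HB// muleCA; congr (_ * _)%E.
  under [RHS]eq_integral do rewrite EFinM.
  rewrite ge0_integralZl//; last first.
    exact/measurable_EFinP.
  rewrite integral_indic ?setIT//.
have : (\int[mu]_x ((H x)%:E * (h n (phi x))%:E) @[n --> \oo]
        --> \int[mu]_x ((H x)%:E * f (phi x)))%E.
  have -> : (\int[mu]_x ((H x)%:E * f (phi x)) =
      \int[mu]_x (limn (fun n => (H x)%:E * (h n (phi x))%:E)))%E.
    apply: eq_integral => x _; apply/esym/cvg_lim => //.
    by apply: cvgeZl => //; exact: hf.
  apply: cvg_monotone_convergence => //.
  - move=> n; apply: emeasurable_funM => //.
    exact: (measurableT_comp (mh n)).
  - by move=> n x _; rewrite mule_ge0// lee_fin.
  - by move=> x _ a b ab; rewrite lee_wpmul2l// ndh.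
under eq_cvg do rewrite hn.
move=> /cvg_lim <-//.
apply/cvg_lim => //; apply: cvgeZl => //.
have -> : (\int[nu]_x f x = \int[nu]_x (limn (fun n => (h n x)%:E)))%E.
  by apply: eq_integral => x _; apply/esym/cvg_lim => //; exact: hf.
apply: cvg_monotone_convergence => //.
- by move=> n x _; rewrite lee_fin.
- by move=> x _ a b ab; exact: ndh.
Qed.

End ge0_integral.

(** Independence enters as a product formula for boxes intersected with [D]. It is carried over to
    functions by replacing the indicators with general factors one at a time. *)
Lemma integral_prod_of_indic d d' (T : measurableType d)
    (T' : measurableType d') (R : realType)
    (mu : {measure set T -> \bar R}) (D : set T) (S : nat -> T -> T')
    (nu : nat -> probability T' R) (c : R) (m : nat)
    (G : nat -> T' -> R) (a : nat -> R) :
  measurable D -> (forall k, measurable_fun setT (S k)) -> 0 <= c ->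
  (forall B : nat -> set T', (forall k, measurable (B k)) ->
    mu (D `&` [set w | forall k, (k < m)%N -> B k (S k w)]) =
    (c%:E * \prod_(k < m) nu k (B k))%E) ->
  (forall k, measurable_fun setT (G k)) -> (forall k x, 0 <= G k x) ->
  (forall k, \int[nu k]_x (G k x)%:E = (a k)%:E)%E ->
  (\int[mu]_(x in D) (\prod_(k < m) G k (S k x))%:E =
   (c * \prod_(k < m) a k)%:E)%E.
Proof.
move=> mD mS c0 HB.
(* Induction on [j]: the factors of index below [j] are arbitrary, the others are indicators. *)
suff main (j : nat) : (j <= m)%N -> forall (G : nat -> T' -> R) (a : nat -> R),
    (forall k, measurable_fun setT (G k)) -> (forall k x, 0 <= G k x) ->
    (forall k, \int[nu k]_x (G k x)%:E = (a k)%:E)%E ->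
    (forall k, (j <= k < m)%N -> exists2 B, measurable B & G k = \1_B) ->
    (\int[mu]_(x in D) (\prod_(k < m) G k (S k x))%:E =
     (c * \prod_(k < m) a k)%:E)%E.
  move=> mG G0 Ga; apply: (main m) => // k.
  by case: leqP.
elim: j {G a} => [_|j IH jm] G a mG G0 Ga indG.
  have /choice[B HBG] : forall k, exists B,
      measurable B /\ ((k < m)%N -> G k = \1_B).
    move=> k; have [km|_] := boolP (k < m)%N; last by exists setT.
    by have [B mB GB] := indG k km; exists B.
  pose A := [set w | forall k, (k < m)%N -> B k (S k w)].
  have mA : measurable A.
    rewrite (_ : A = \bigcap_(k in [set k | (k < m)%N]) (S k @^-1` B k)).
      apply: bigcap_measurableType => // k _.
      by rewrite -[X in measurable X]setTI; apply: mS => //; case: (HBG k).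
    by apply/seteqP; split => x /= Ax k /Ax.
  transitivity (\int[mu]_(x in D) (\1_A x)%:E)%E.
    apply: eq_integral => x _; congr EFin; rewrite indicE.
    have [xA|xA] := boolP (x \in A).
      rewrite big1// => -[k /= km] _; rewrite (HBG k).2// indicE mem_set//.
      by move/set_mem : xA; apply.
    have /existsNP[k /not_implyP[km kB]] : ~ A x by move=> /mem_set; exact/negP.
    rewrite (bigD1 (Ordinal km))//= (HBG k).2// indicE memNset// mul0r//.
  rewrite integral_indic// setIC HB; last by move=> k; case: (HBG k).
  rewrite EFinM; congr (_ * _)%E; rewrite -prodEFin; apply: eq_bigr => k _.
  rewrite -Ga (HBG k).2// integral_indic ?setIT//; by case: (HBG k).
pose j' := Ordinal jm.
(* [H] gathers all factors but the [j]-th. The induction hypothesis, with [G j] replaced by an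
   indicator, says that [S j] carries the measure of density [H] to [C * nu j]. *)
pose H x := \1_D x * \prod_(k < m | k != j') G k (S k x).
pose C := c * \prod_(k < m | k != j') a k.
have a0 k : 0 <= a k.
  by rewrite -lee_fin -Ga integral_ge0// => x _; rewrite lee_fin.
have mH : measurable_fun setT H.
  apply: measurable_funM; first exact: measurable_indic.
  under eq_fun do rewrite -big_filter; apply: measurable_prod => k _.
  exact: (measurableT_comp (mG k) (mS k)).
transitivity (\int[mu]_x ((H x)%:E * (G j (S j x))%:E))%E.
  rewrite integral_mkcond; apply: eq_integral => x _.
  rewrite patchE /H indicE; case: ifP => _; last by rewrite mul0r mul0e.
  by rewrite mul1r -EFinM (bigD1 j')//= mulrC.
rewrite (@ge0_integral_image_measure _ _ _ _ _ mu (nu j) (S j) H C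
  (fun y => (G j y)%:E))//.
- by rewrite Ga (bigD1 j')//= /C -EFinM -mulrA [a j * _]mulrC.
- move=> x; rewrite mulr_ge0// ?prodr_ge0//.
- move=> B mB.
  pose G' k := if k == j then \1_B else G k.
  pose a' k := if k == j then fine (nu j B) else a k.
  transitivity (\int[mu]_(x in D) (\prod_(k < m) G' k (S k x))%:E)%E.
    rewrite [RHS]integral_mkcond; apply: eq_integral => x _.
    rewrite patchE /H indicE; case: ifP => _; last by rewrite mul0r mul0e.
    rewrite mul1r -EFinM [in RHS](bigD1 j')//= mulrC /G' eqxx.
    congr (_ * _)%:E; apply: eq_bigr => k kj; rewrite ifF//.
    by apply/negbTE.
  rewrite (IH _ _ a').
  + rewrite (bigD1 j')//= /a' eqxx mulrCA mulrC EFinM fineK ?fin_num_measure//.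
    congr ((_ * _)%:E * _)%E; apply: eq_bigr => k kj; rewrite ifF//.
    exact/negbTE.
  + exact: ltnW.
  + by move=> k; rewrite /G'; case: ifP => // _; exact: measurable_indic.
  + by move=> k x; rewrite /G'; case: ifP.
  + move=> k; rewrite /G' /a'; case: eqP => [->|//].
    by rewrite integral_indic// setIT fineK ?fin_num_measure.
  + move=> k /andP[jk km]; rewrite /G'; case: eqP => [_|/eqP kj].
      by exists B.
    by apply: indG; rewrite ltn_neqAle eq_sym kj jk.
- by rewrite mulr_ge0// prodr_ge0.
- exact/measurable_EFinP.
- by move=> y; rewrite lee_fin.
Qed.

(** The factor [expR (- d * x)] turns the exponential density of rate [q] into [q / (q + d)] times
    the density of rate [q + d], which has total mass 1. *)
Lemma integral_expR_exponential (R : realType) (q d : R)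
    (nu : {measure set (measurableTypeR R) -> \bar R}) :
  0 < q -> 0 <= d -> (forall B, nu B = exponential_prob q B) ->
  (\int[nu]_x (expR (- d * x))%:E = (q / (q + d))%:E)%E.
Proof.
move=> q0 d0 nuE.
have qd0 : 0 < q + d by rewrite ltr_wpDr.
have mexp : measurable_fun setT (fun x : R => expR (- d * x)).
  apply: measurableT_comp => //.
have := @ge0_integral_image_measure _ _ _ _ _ lebesgue_measure nu idfun
  (exponential_pdf q) 1 (fun x => (expR (- d * x))%:E).
rewrite mul1e => <-//.
- transitivity (\int[lebesgue_measure]_x
    ((q / (q + d))%:E * (exponential_pdf (q + d) x)%:E))%E.
    apply: eq_integral => x _; rewrite -!EFinM; congr EFin.
    have [x0|x0] := leP 0 x; last by rewrite !lt0_exponential_pdf// mul0r mulr0.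
    rewrite !exponential_pdfE// mulrA divfK ?gt_eqF// -mulrA -expRD.
    by rewrite opprD mulrDl.
  rewrite ge0_integralZl//.
  + by rewrite integral_exponential_pdf// mule1.
  + by apply/measurable_EFinP; exact: measurable_exponential_pdf.
  + by move=> x _; rewrite lee_fin exponential_pdf_ge0// ltW.
  + by rewrite lee_fin divr_ge0// ltW.
- exact: measurable_id.
- exact: measurable_exponential_pdf.
- by move=> x; rewrite exponential_pdf_ge0// ltW.
- move=> B mB; rewrite mul1e nuE /exponential_prob [RHS]integral_mkcond.
  apply: eq_integral => x _; rewrite patchE indicE.
  by case: ifP => _; rewrite ?mule1 ?mule0.
- exact/measurable_EFinP.
Qed.

(** * Discounted passage along the jump chain *)

Section jump_chain.
Context (R : realType) (disp : measure_display) (T : measurableType disp)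
  (P : probability T R) (Q : nat -> nat -> R)
  (Y : nat -> {RV P >-> nat}) (S : nat -> {RV P >-> R}).

Definition jump_law : Prop :=
  forall (m : nat) (y : nat -> nat) (B : nat -> set R),
    (forall k, measurable (B k)) ->
    P [set w | (forall k, (k <= m)%N -> Y k w = y k) /\
               (forall k, (k < m)%N -> B k (S k w))] =
    (P [set w | Y 0%N w = y 0%N] *
     \prod_(k < m) (exponential_prob (- Q (y k) (y k)) (B k) *
                    (jump_prob Q (y k) (y k.+1))%:E))%E.

(** This is [jump_prob] times the Laplace transform [- Q i i / (d i - Q i i)] of the holding time,
    that is, the jump probability for the process killed at rate [d i] while in [i]. *)
Definition killed_jump (d : nat -> R) (i j : nat) : R :=
  if i == j then 0 else Q i j / (d i - Q i i).

(* The weight of the paths from [i] to [n] with [r.+1] jumps that stay below [n]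
   before the last one. *)
Fixpoint first_passage (d : nat -> R) (n r i : nat) : R :=
  if r is r'.+1 then \sum_(j < n) killed_jump d i j * first_passage d n r' j
  else killed_jump d i n.

(** When [n] is first reached at jump [m], this is almost surely the integrand of the theorem; see
    [expeR_occupation_time]. *)
Definition discount (d : nat -> R) (m : nat) (w : T) : R :=
  expR (- \sum_(k < m) d (Y k w) * S k w).

Lemma measurable_jump_event (C : nat -> set nat) :
  measurable [set w | forall k, C k (Y k w)].
Proof.
rewrite (_ : mkset _ = \bigcap_k (Y k @^-1` C k)).
  apply: bigcap_measurableType => k _; rewrite -[X in measurable X]setTI.
  exact: measurable_funP.
by apply/seteqP; split => w /= H k; [move=> _|]; exact: H.
Qed.

Lemma measurable_discount (d : nat -> R) m : measurable_fun setT (discount d m).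
Proof.
apply: measurableT_comp => //; apply: measurable_funN.
apply: measurable_sum => k _; apply: measurable_funM => //.
exact: (measurableT_comp (_ : measurable_fun setT d)).
Qed.

Hypothesis Qdiag : forall i, Q i i < 0.
Hypothesis Qoff : forall i j : nat, i <> j -> 0 <= Q i j.
Hypothesis law : jump_law.

Let Nq0 i : 0 < - Q i i. Proof. by rewrite oppr_gt0. Qed.

Lemma jump_prob_ge0 i j : 0 <= jump_prob Q i j.
Proof.
rewrite /jump_prob; case: eqP => // ij; apply: divr_ge0; first exact: Qoff.
exact: ltW.
Qed.

(** On the event the states are constants, so [discount] is a product of functions of the separate
    holding times. Each contributes its Laplace transform, which turns [jump_prob] into
    [killed_jump]. *)
Lemma integral_discount_path (d : nat -> R) (m : nat) (y : nat -> nat) :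
  (forall i, 0 <= d i) ->
  (\int[P]_(w in [set w | forall k, (k <= m)%N -> Y k w = y k])
     (discount d m w)%:E =
   (fine (P [set w | Y 0%N w = y 0%N]) *
    \prod_(k < m) killed_jump d (y k) (y k.+1))%:E)%E.
Proof.
move=> d0.
(* The probability structure of [exponential_prob] is named explicitly in order to supply the
   positivity of the rate. *)
pose nu k : probability (measurableTypeR R) R :=
  exponential_distribution_exponential_prob__canonical__probability_measure_Probability
    (Nq0 (y k)).
pose c := fine (P [set w | Y 0%N w = y 0%N]) *
          \prod_(k < m) jump_prob Q (y k) (y k.+1).
pose a k := - Q (y k) (y k) / (- Q (y k) (y k) + d (y k)).
transitivity (\int[P]_(w in [set w | forall k, (k <= m)%N -> Y k w = y k])
    (\prod_(k < m) expR (- d (y k) * S k w))%:E)%E.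
  apply: eq_integral => w /set_mem /= yw; rewrite /discount -sumrN expR_sum.
  by congr EFin; apply: eq_bigr => k _; rewrite yw ?mulNr// ltnW.
rewrite (integral_prod_of_indic (T' := measurableTypeR R) (mu := P)
  (S := fun k => S k) (nu := nu)
  (c := c) (G := fun k x => expR (- d (y k) * x)) (a := a)).
- congr EFin; rewrite /c -mulrA -big_split/=; congr (_ * _).
  apply: eq_bigr => k _; rewrite /jump_prob /killed_jump /a.
  case: eqP => _; first by rewrite mul0r.
  by rewrite mulrA divfK ?gt_eqF// addrC.
- exact: (measurable_jump_event (fun k => [set v | (k <= m)%N -> v = y k])).

- by move=> k; have := @measurable_funPT _ _ _ _ (S k); exact.
- rewrite /c mulr_ge0 ?fine_ge0// prodr_ge0// => k _.
  exact: jump_prob_ge0.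
- move=> B mB; have := @law m y B mB.
  rewrite [X in P X](_ : _ = [set w | forall k, (k <= m)%N -> Y k w = y k] `&`
    [set w | forall k, (k < m)%N -> B k (S k w)])//.
  move=> lawB; apply: (etrans lawB); rewrite big_split/= /c.
  rewrite EFinM fineK ?fin_num_measure//.
    by rewrite -muleA [(_ * \prod_(_ < _) _)%E in RHS]muleC prodEFin.
  rewrite (_ : mkset _ = Y 0%N @^-1` [set y 0%N])// -[X in measurable X]setTI.
  exact: measurable_funP.
- by move=> k; apply: measurableT_comp => //; apply: measurable_funM.
- by move=> k x; exact: expR_ge0.
- by move=> k; apply: integral_expR_exponential.
Qed.

(* Along [y] up to step [l], then below [n], then at [n] at step [l.+1 + r]. *)
Definition passage_event (n l r : nat) (y : nat -> nat) : set T :=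
  [set w | forall k, [/\ (k <= l)%N -> Y k w = y k,
                         (l < k < l.+1 + r)%N -> (Y k w < n)%N &
                         k = (l.+1 + r)%N -> Y k w = n]].

Lemma measurable_passage_event n l r y : measurable (passage_event n l r y).
Proof.
exact: (measurable_jump_event (fun k => [set v | [/\ (k <= l)%N -> v = y k,
  (l < k < l.+1 + r)%N -> (v < n)%N & k = (l.+1 + r)%N -> v = n]])).
Qed.

(** The prescribed segment [y] serves the induction on [r]: splitting on the state [j] at step
    [l.+1] and adding it to the segment mirrors the recursion of [first_passage]. The law of first
    passage is the case [l = 0]. *)
Lemma integral_discount_passage (d : nat -> R) (n l r : nat) (y : nat -> nat) :
  (forall i, 0 <= d i) ->
  (\int[P]_(w in passage_event n l r y) (discount d (l.+1 + r) w)%:E =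
   (fine (P [set w | Y 0%N w = y 0%N]) *
    (\prod_(k < l) killed_jump d (y k) (y k.+1)) *
    first_passage d n r (y l))%:E)%E.
Proof.
move=> d0.
pose upd l (y : nat -> nat) j := fun k => if k == l.+1 then j else y k.
have prodU l' (y' : nat -> nat) j :
    \prod_(k < l'.+1) killed_jump d (upd l' y' j k) (upd l' y' j k.+1) =
    (\prod_(k < l') killed_jump d (y' k) (y' k.+1)) * killed_jump d (y' l') j.
  rewrite big_ord_recr/= /upd eqxx (ltn_eqF (ltnSn _)); congr (_ * _).
  apply: eq_bigr => -[k kl] _ /=.
  by rewrite eqSS (ltn_eqF kl) (ltn_eqF (leqW kl)).
elim: r l y => [|r IH] l y.
  rewrite addn0 /=.
  have -> : passage_event n l 0 y =
      [set w | forall k, (k <= l.+1)%N -> Y k w = upd l y n k].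
    apply/seteqP; split => w /= H k.
      have [H1 _ H2] := H k; rewrite /upd; case: eqP => [kl _|kl].
        by rewrite H2// addn0.
      by rewrite leq_eqVlt => /predU1P[//|]; rewrite ltnS; exact: H1.
    rewrite addn0; split => [kl|/andP[lk]|kl].
    - by rewrite H ?leqW// /upd ltn_eqF.
    - by rewrite ltnNge lk.
    - by rewrite H ?kl// /upd eqxx.
  by rewrite integral_discount_path// prodU mulrA.
have passageU : passage_event n l r.+1 y =
    \big[setU/set0]_(j <- iota 0 n) passage_event n l.+1 r (upd l y j).
  rewrite -bigcup_seq; apply/seteqP; split => w /=.
    move=> H; exists (Y l.+1 w) => /=.
      by rewrite mem_iota add0n; have [_ H1 _] := H l.+1; apply: H1;
        rewrite ltnSn/= addnS ltnS leq_addr.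
    move=> k; have [H1 H2 H3] := H k; split.
    - rewrite /upd; case: eqP => [->//|/eqP kl].
      rewrite leq_eqVlt (negbTE kl)/=.
      exact: H1.
    - by rewrite addSnnS => /andP[lk ?]; apply: H2; rewrite (ltnW lk).
    - by rewrite addSnnS => ?; exact: H3.
  move=> [j /=]; rewrite mem_iota add0n => jn H k.
  have [H1 H2 H3] := H k; split.
  - by move=> kl; rewrite H1 ?leqW// /upd ltn_eqF.
  - move=> /andP[lk]; rewrite -addSnnS => kr.
    have [kl|kl] := eqVneq k l.+1; first by rewrite H1 ?kl// /upd eqxx.
    by apply: H2; rewrite kr ltn_neqAle eq_sym kl lk.
  - by rewrite -addSnnS => ?; exact: H3.
rewrite passageU ge0_integral_bigsetU//; last 5 first.
- by move=> j; exact: measurable_passage_event.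
- exact: iota_uniq.
- apply/trivIsetP => i j _ _ ij; apply/seteqP; split => w //= -[Hi Hj].
  have [/(_ (leqnn _)) Yi _ _] := Hi l.+1.
  have [/(_ (leqnn _)) Yj _ _] := Hj l.+1.
  by move: ij Yi Yj; rewrite /upd eqxx => /eqP ij -> /ij.
- apply/measurable_EFinP; apply: measurable_funTS; exact: measurable_discount.
- by move=> w _; rewrite lee_fin expR_ge0.
rewrite (_ : iota 0 n = index_iota 0 n) ?big_mkord; last first.
  by rewrite /index_iota subn0.
rewrite -[(l.+1 + r.+1)%N]addSnnS.
under eq_bigr do rewrite IH prodU.
rewrite sumEFin; congr EFin; rewrite /= mulr_sumr; apply: eq_bigr => j _.
by rewrite /upd eqxx/= !mulrA.
Qed.

End jump_chain.

(** * Passage series and determinants *)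

(* Cramer's rule: deleting the last row and the first column of a lower
   Hessenberg matrix leaves a triangular matrix with the superdiagonal of [A]
   on its diagonal. *)
Lemma det_hessenberg_mul (K : fieldType) (n : nat) (A : 'M[K]_n.+1)
    (u : 'I_n.+1 -> K) (b : K) :
  (forall i j : 'I_n.+1, (i.+1 < j)%N -> A i j = 0) ->
  (forall i, \sum_j A i j * u j = if i == ord_max then b else 0) ->
  \det A * u ord0 =
  (-1) ^+ n * (\prod_(i < n) A (widen_ord (leqnSn n) i) (lift ord0 i)) * b.
Proof.
move=> hess Au.
pose U : 'cV[K]_n.+1 := \col_i u i.
pose W : 'cV[K]_n.+1 := \col_i (if i == ord_max then b else 0).
have AU : A *m U = W.
  apply/matrixP => i j; rewrite !mxE -Au.
  by apply: eq_bigr => k _; rewrite mxE.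
have : (\adj A *m W) ord0 ord0 = \det A * u ord0.
  by rewrite -AU mulmxA mul_adj_mx mul_scalar_mx !mxE.
rewrite mxE (bigD1 ord_max)//= big1 ?addr0 => [<-|i /negbTE iN]; last first.
  by rewrite [W _ _]mxE iN mulr0.
rewrite [W _ _]mxE eqxx [\adj A _ _]mxE /cofactor/= addn0; congr (_ * _ * _).
rewrite det_trig; last first.
  apply/is_trig_mxP => i j ij; rewrite !mxE; apply: hess.
  by rewrite lift0 lift_max ltnS.
apply: eq_bigr => i _; rewrite !mxE; congr (A _ _).
by apply: val_inj; exact: lift_max.
Qed.

Section first_passage_series.
Context (R : realType) (Q : nat -> nat -> R).
Hypothesis Qoff : forall i j : nat, i <> j -> 0 <= Q i j.
Hypothesis Qup : forall i : nat, 0 < Q i i.+1.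
Hypothesis Qskip : forall i j : nat, (i.+1 < j)%N -> Q i j = 0.
Hypothesis Qrow : forall i : nat, \sum_(j < i.+2) Q i j = 0.

Lemma generator_diag_lt0 i : Q i i < 0.
Proof.
have := Qrow i; rewrite big_ord_recr/= big_ord_recr/= => /eqP.
rewrite addrAC addr_eq0 => /eqP QE.
rewrite -oppr_gt0 -QE ltr_wpDl// sumr_ge0// => -[j ji] _ /=.
by apply: Qoff => jE; move: ji; rewrite jE ltnn.
Qed.

Lemma generator_row_sum n i : (i < n)%N -> \sum_(j < n.+1) Q i j = 0.
Proof.
move=> iN; rewrite -[RHS](Qrow i) [RHS](big_ord_widen n.+1 (fun j => Q i j))//.
rewrite [RHS]big_mkcond/=; apply: eq_bigr => j _; case: ifPn => //.
by rewrite -leqNgt => ?; exact: Qskip.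
Qed.

Lemma generator_row_offdiag n i : (i < n)%N ->
  \sum_(j < n) (if i == j then 0 else Q i j) + Q i n = - Q i i.
Proof.
move=> iN; apply/eqP; rewrite -addr_eq0; apply/eqP.
rewrite -[RHS](generator_row_sum iN) big_ord_recr/= addrAC; congr (_ + _).
rewrite (bigD1 (Ordinal iN))//= eqxx add0r [RHS](bigD1 (Ordinal iN))//= addrC.
congr (_ + _); apply: eq_bigr => j; rewrite -val_eqE/= => ji.
by rewrite eq_sym (negbTE ji).
Qed.

Variable d : nat -> R.
Hypothesis d0 : forall i, 0 <= d i.

Let den_gt0 i : 0 < d i - Q i i.
Proof. by rewrite ltr_wpDl// oppr_gt0 generator_diag_lt0. Qed.

Lemma killed_jump_ge0 i j : 0 <= killed_jump Q d i j.
Proof.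
rewrite /killed_jump; case: eqP => // ij.
by apply: divr_ge0; [exact: Qoff|exact: ltW].
Qed.

Lemma first_passage_ge0 n r i : 0 <= first_passage Q d n r i.
Proof.
elim: r i => [|r IH] i /=; first exact: killed_jump_ge0.
by rewrite sumr_ge0// => j _; rewrite mulr_ge0// killed_jump_ge0.
Qed.

(** By the zero row sum the left side is [- Q i i / (d i - Q i i)]. This substochastic bound keeps
    the partial sums of the passage series below 1. *)
Lemma killed_jump_le1 n i : (i < n)%N ->
  killed_jump Q d i n + \sum_(j < n) killed_jump Q d i j <= 1.
Proof.
move=> iN.
have -> : killed_jump Q d i n + \sum_(j < n) killed_jump Q d i j =
    - Q i i / (d i - Q i i).
  rewrite -[X in _ = X / _](generator_row_offdiag iN) addrC mulrDl mulr_suml.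
  congr (_ + _); last by rewrite /killed_jump ltn_eqF.
  by apply: eq_bigr => j _; rewrite /killed_jump; case: ifP; rewrite ?mul0r.
by rewrite ler_pdivrMr// mul1r lerDr.
Qed.

(** First-step decomposition of the partial sums; its limit is the linear system
    [total_passage_eq]. *)
Lemma sum_first_passageS n N i :
  \sum_(r < N.+1) first_passage Q d n r i = killed_jump Q d i n +
  \sum_(j < n) killed_jump Q d i j * \sum_(r < N) first_passage Q d n r j.
Proof.
rewrite big_ord_recl/=; congr (_ + _).
rewrite exchange_big/=; apply: eq_bigr => j _.
by rewrite mulr_sumr.
Qed.

Lemma sum_first_passage_le1 n N i : (i < n)%N ->
  \sum_(r < N) first_passage Q d n r i <= 1.
Proof.
elim: N i => [|N IH] i iN; first by rewrite big_ord0.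
rewrite sum_first_passageS (le_trans _ (killed_jump_le1 iN))// lerD2l.
apply: ler_sum => j _; rewrite ler_piMr ?killed_jump_ge0//; exact: IH.
Qed.

(** For [i < n], the probability that the process started at [i] and killed at rates [d] ever
    reaches [n]. *)
Definition total_passage n i : R :=
  limn (fun N => \sum_(r < N) first_passage Q d n r i).

Lemma cvg_sum_first_passage n i : (i < n)%N ->
  \sum_(r < N) first_passage Q d n r i @[N --> \oo] --> total_passage n i.
Proof.
move=> iN; apply: nondecreasing_is_cvgn.
  apply/nondecreasing_seqP => N; rewrite big_ord_recr/= lerDl.
  exact: first_passage_ge0.
by exists 1 => _ [N _ <-]; exact: sum_first_passage_le1.
Qed.

Lemma total_passage_eq n i : (i < n)%N ->
  total_passage n i = killed_jump Q d i n +
    \sum_(j < n) killed_jump Q d i j * total_passage n j.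
Proof.
move=> iN.
have h1 : \sum_(r < N.+1) first_passage Q d n r i @[N --> \oo]
    --> total_passage n i.
  have := cvg_sum_first_passage iN.
  by rewrite -(cvg_shiftS (fun N => \sum_(r < N) first_passage Q d n r i)).
have h2 : \sum_(r < N.+1) first_passage Q d n r i @[N --> \oo] -->
    killed_jump Q d i n + \sum_(j < n) killed_jump Q d i j * total_passage n j.
  under eq_fun do rewrite sum_first_passageS.
  apply: cvgD; first exact: cvg_cst.
  apply: cvg_big => [|j _]; first exact: add_continuous.
  apply: cvgMl_tmp.
  exact: cvg_sum_first_passage.
exact: cvg_unique h1 h2.
Qed.

(** Multiplying [total_passage_eq] by [d i - Q i i] clears the denominators and restores the
    diagonal term that [killed_jump] omits, giving row [i] of the system for [D - Qn]. *)
Lemma total_passage_mul n i : (i < n)%N ->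
  d i * total_passage n i - \sum_(j < n) Q i j * total_passage n j = Q i n.
Proof.
move=> iN.
have := total_passage_eq iN.
move=> /(congr1 ( *%R (d i - Q i i))).
rewrite mulrDr {1}/killed_jump ltn_eqF// mulrC [_ * (_ / _)]mulrC.
rewrite divfK ?gt_eqF//.
rewrite mulr_sumr => E; rewrite (bigD1 (Ordinal iN))//= opprD addrA.
rewrite -mulrBl mulrC E -addrA [X in _ + X](_ : _ = 0) ?addr0//.
apply/eqP; rewrite subr_eq0 (bigD1 (Ordinal iN))//= /killed_jump eqxx.
rewrite mul0r mulr0 add0r; apply/eqP; apply: eq_bigr => j.
rewrite -val_eqE/= => ji; rewrite eq_sym (negbTE ji) mulrA.
by rewrite [_ * (_ / _)]mulrC divfK ?gt_eqF.
Qed.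

End first_passage_series.

(** Column [n.+1] lies just to the right of the block of size [n.+1]; this brings it to the shape of
    the right-hand side in [det_hessenberg_mul]. *)
Lemma generator_last_col (R : realType) (Q : nat -> nat -> R) (n : nat) :
  (forall i j : nat, (i.+1 < j)%N -> Q i j = 0) ->
  forall i : 'I_n.+1, Q i n.+1 = if i == ord_max then Q n n.+1 else 0.
Proof.
move=> Qskip i; case: eqP => [->//|/eqP]; rewrite -val_eqE/= => iN.
by apply: Qskip; rewrite ltnS ltn_neqAle iN -ltnS ltn_ord.
Qed.

(* The constant vector 1 is sent by [- Qn] to a multiple of the last basis
   vector, since the full rows of [Q] sum to zero. *)
Lemma det_opp_generator (R : realType) (Q : nat -> nat -> R) (n : nat) :
  (forall i j : nat, (i.+1 < j)%N -> Q i j = 0) ->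
  (forall i : nat, \sum_(j < i.+2) Q i j = 0) ->
  \det (- \matrix_(i < n, j < n) Q i j) = \prod_(i < n) Q i i.+1.
Proof.
move=> Qskip Qrow; case: n => [|n]; first by rewrite det_mx00 big_ord0.
have := @det_hessenberg_mul _ n (- \matrix_(i, j) Q i j) (fun=> 1) (Q n n.+1).
rewrite mulr1 => ->.
(* The sign of the cofactor cancels the signs of the [n] negated superdiagonal entries; [Q n n.+1]
   is the last factor of the product. *)
- rewrite big_ord_recr/=; congr (_ * _); under eq_bigr do rewrite !mxE lift0.
  by rewrite prodrN card_ord mulrA -exprD addnn -signr_odd odd_double mul1r.
- by move=> i j ij; rewrite !mxE Qskip ?oppr0.
- move=> i; rewrite -(generator_last_col Qskip).
  have := generator_row_sum Qskip Qrow (ltn_ord i).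
  rewrite big_ord_recr/= => /eqP; rewrite addrC addr_eq0 => /eqP ->.
  by rewrite -sumrN; apply: eq_bigr => j _; rewrite !mxE mulr1.
Qed.

Lemma det_opp_generator_neq0 (R : realType) (Q : nat -> nat -> R) (n : nat) :
  (forall i : nat, 0 < Q i i.+1) ->
  (forall i j : nat, (i.+1 < j)%N -> Q i j = 0) ->
  (forall i : nat, \sum_(j < i.+2) Q i j = 0) ->
  \det (- \matrix_(i < n, j < n) Q i j) != 0.
Proof.
move=> Qup Qskip Qrow; rewrite det_opp_generator//.
by apply/prodf_neq0 => i _; rewrite gt_eqF.
Qed.

Lemma det_total_passage (R : realType) (Q : nat -> nat -> R) (d : nat -> R)
    (n : nat) :
  (forall i j : nat, i <> j -> 0 <= Q i j) ->
  (forall i : nat, 0 < Q i i.+1) ->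
  (forall i j : nat, (i.+1 < j)%N -> Q i j = 0) ->
  (forall i : nat, \sum_(j < i.+2) Q i j = 0) ->
  (forall i, 0 <= d i) -> (0 < n)%N ->
  let Qn : 'M[R]_n := \matrix_(i < n, j < n) Q i j in
  let D : 'M[R]_n := diag_mx (\row_(i < n) d i) in
  total_passage Q d n 0 = \det (- Qn) / \det (D - Qn).
Proof.
move=> Qoff Qup Qskip Qrow d0; case: n => // n _ Qn D.
have Qn0 : \det (- Qn) != 0 by exact: det_opp_generator_neq0.
(* This identity also shows that [\det (D - Qn)] is nonzero, since its right-hand side is. *)
suff DQn : \det (D - Qn) * total_passage Q d n.+1 0 = \det (- Qn).
  rewrite -[X in X / _]DQn mulrAC divff ?mul1r//.
  by apply: contra_neq Qn0; rewrite -DQn => ->; rewrite mul0r.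
have := @det_hessenberg_mul _ n (D - Qn)
  (fun i => total_passage Q d n.+1 i) (Q n n.+1).
move=> ->.
- rewrite det_opp_generator// big_ord_recr/=; congr (_ * _).
  under eq_bigr => i _.
    rewrite !mxE lift0 (_ : (_ == _) = false) ?mulr0n ?sub0r; last first.
      by apply/eqP => /(congr1 val) /=; rewrite /bump/= add1n => /n_Sn.
    over.
  by rewrite prodrN card_ord mulrA -exprD addnn -signr_odd odd_double mul1r.
- move=> i j ij; rewrite !mxE Qskip// -val_eqE/= ltn_eqF ?subr0//.
  exact: ltnW.
- move=> i; rewrite -(generator_last_col Qskip).
  rewrite -(total_passage_mul Qoff Qup Qskip Qrow d0 (ltn_ord i)).
  transitivity (\sum_j (D i j * total_passage Q d n.+1 j -
                        Q i j * total_passage Q d n.+1 j)).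
    by apply: eq_bigr => j _; rewrite -mulrBl !mxE.
  rewrite sumrB; congr (_ - _); rewrite (bigD1 i)//= big1 ?addr0.
    by rewrite !mxE eqxx mulr1n.
  by move=> j ji; rewrite !mxE eq_sym (negbTE ji) mulr0n mul0r.
Qed.

(** * Pure jump paths *)

Section pure_jump_path.
Context (R : realType) (T : Type) (X : R -> T -> nat) (w : T)
  (y : nat -> nat) (s : nat -> R).
Hypothesis s_gt0 : forall k, 0 < s k.
Hypothesis Xy : forall (k : nat) (t : R),
  \sum_(i < k) s i <= t < \sum_(i < k.+1) s i -> X t w = y k.

Let jump_time (k : nat) : R := \sum_(i < k) s i.

Let jump_timeS k : jump_time k.+1 = jump_time k + s k.
Proof. exact: big_ord_recr. Qed.

Let jump_time_ge0 k : 0 <= jump_time k.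
Proof. by rewrite sumr_ge0// => i _; exact: ltW. Qed.

Let le_jump_time : {homo jump_time : j k / (j <= k)%N >-> j <= k}.
Proof.
by apply: homo_leq => [//||k]; [exact: le_trans|rewrite jump_timeS lerDl ltW].
Qed.

Lemma jump_intervalP m t : 0 <= t < jump_time m ->
  exists2 k, (k < m)%N & jump_time k <= t < jump_time k.+1.
Proof.
elim: m => [|m IH] /andP[t0 tm].
  by move: tm; rewrite /jump_time big_ord0 ltNge t0.
have [tm'|tm'] := ltP t (jump_time m).
  by have [|k km kt] := IH; [rewrite t0|exists k => //; exact: ltnW].
by exists m => //; rewrite tm'.
Qed.

Variables (n m : nat).
Hypothesis ym : y m = n.
Hypothesis yn : forall k, (k < m)%N -> y k <> n.

Let X_jump_time : X (jump_time m) w = n.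
Proof.
by rewrite -ym; apply: Xy; rewrite lexx/= -/(jump_time m.+1) jump_timeS ltrDl.
Qed.

(** The infimum is attained at the [m]-th jump time: any earlier time lies in an interval of index
    [k < m], where the state is [y k], different from [n]. *)
Lemma hitting_time_jump : hitting_time X n w = (\sum_(i < m) s i)%:E.
Proof.
apply/eqP; rewrite eq_le; apply/andP; split.
  by apply: ereal_inf_lbound; exists (jump_time m).
apply: le_ereal_inf_tmp => _ [t [t0 Xt] <-]; rewrite lee_fin leNgt.
apply/negP => tm; have [|k km kt] := @jump_intervalP m t; first by rewrite t0.
by apply: (yn km); rewrite -(Xy kt).
Qed.

(** Up to the hitting time, the indicator of state [i] is a sum of indicators of the holding
    intervals [J k] with [y k = i], and [J k] has length [s k]. *)
Lemma occupation_time_jump i : i <> n ->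
  occupation_time X i n w = (\sum_(k < m) (y k == i)%:R * s k)%:E.
Proof.
move=> iNn; rewrite /occupation_time hitting_time_jump.
rewrite (_ : mkset _ = `[0, jump_time m]%classic); last first.
  by apply/seteqP; split => t /=; rewrite in_itv/= !lee_fin.
pose J k := `[jump_time k, jump_time k.+1[%classic : set R.
transitivity (\int[lebesgue_measure]_(t in `[0%R, jump_time m]%classic)
    (\sum_(k < m) ((y k == i)%:R * \1_(J k) t)%:E))%E.
  apply: eq_integral => t; rewrite inE/= in_itv/= => /andP[t0].
  (* The closed right endpoint lies in no [J k] with [k < m]; the state there is [n], so both sides
     vanish because [i <> n]. *)
  rewrite sumEFin le_eqVlt => /predU1P[->|tm]; congr EFin.
    rewrite indicE memNset; last by rewrite /= X_jump_time => /esym.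
    rewrite big1// => k _; rewrite indicE memNset ?mulr0// /J/=.
    rewrite in_itv/= => /andP[_].
    by rewrite ltNge le_jump_time.
  have [|k km kt] := @jump_intervalP m t; first by rewrite t0.
  rewrite (bigD1 (Ordinal km))//= big1 ?addr0.
    rewrite [\1_(J k) _]indicE mem_set ?mulr1//.
    rewrite indicE; congr (nat_of_bool _)%:R; apply/idP/eqP => [|<-].
      by rewrite inE/= => <-; rewrite (Xy kt).
    by rewrite inE/= (Xy kt).
  move=> j; rewrite -val_eqE/= => jk; rewrite indicE memNset ?mulr0// /J/=.
  rewrite in_itv/= => /andP[jt tj]; move/andP : kt => [kt tk].
  move: jk; rewrite neq_ltn => /orP[jk|kj].
    by move: (lt_le_trans tj (le_trans (le_jump_time jk) kt)); rewrite ltxx.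
  by move: (lt_le_trans tk (le_trans (le_jump_time kj) jt)); rewrite ltxx.
rewrite ge0_integral_sum//; last first.
- move=> k; apply/measurable_EFinP; apply: measurable_funM => //.
  by apply: measurable_indic; exact: measurable_itv.
rewrite -sumEFin; apply: eq_bigr => k _.
under eq_integral do rewrite EFinM.
rewrite ge0_integralZl//; last first.
  by apply/measurable_EFinP; apply: measurable_indic; exact: measurable_itv.
rewrite integral_indic//; last exact: measurable_itv.
rewrite EFinM; congr (_ * _)%E; rewrite (_ : _ `&` _ = J k); last first.
  rewrite /J; apply/setIidPl => t /=; rewrite !in_itv/= => /andP[kt tk].
  rewrite (le_trans _ kt)//= (le_trans (ltW tk))//; exact: le_jump_time.
apply: (etrans (lebesgue_measure_itv _)); rewrite /= lte_fin.
rewrite jump_timeS ltrDl s_gt0.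
by rewrite -EFinB addrAC subrr add0r.
Qed.

End pure_jump_path.

Lemma expeR_occupation_time (R : realType) (T : Type) (X : R -> T -> nat)
    (w : T) (y : nat -> nat) (s : nat -> R) (n m : nat) (d : nat -> R) :
  (forall k, 0 < s k) ->
  (forall (k : nat) (t : R),
    \sum_(i < k) s i <= t < \sum_(i < k.+1) s i -> X t w = y k) ->
  y m = n -> (forall k, (k < m)%N -> (y k < n)%N) ->
  (expeR (- \sum_(i < n) (d i)%:E * occupation_time X i n w) =
   (expR (- \sum_(k < m) d (y k) * s k))%:E)%E.
Proof.
move=> s0 Xy ym yn.
have occ (i : 'I_n) : occupation_time X i n w =
    (\sum_(k < m) (y k == i)%:R * s k)%:E.
  apply: occupation_time_jump => //.
  - by move=> k km /eqP; rewrite ltn_eqF// yn.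
  - by apply/eqP; rewrite ltn_eqF.
under eq_bigr do rewrite occ -EFinM.
rewrite sumEFin -EFinN /=; congr (expR (- _))%:E.
(* After exchanging the sums, each [k] selects the single state [i = y k], which is below [n]. *)
under eq_bigr do rewrite mulr_sumr.
rewrite exchange_big/=; apply: eq_bigr => k _.
rewrite (bigD1 (Ordinal (yn _ (ltn_ord k))))//= eqxx mul1r big1 ?addr0// => i.
by rewrite -val_eqE/= eq_sym => /negbTE ->; rewrite mul0r mulr0.
Qed.

(** * Law of the first passage *)

Section passage_law.
Context (R : realType) (disp : measure_display) (T : measurableType disp)
  (P : probability T R) (Q : nat -> nat -> R)
  (Y : nat -> {RV P >-> nat}) (S : nat -> {RV P >-> R}).
Hypothesis Qoff : forall i j : nat, i <> j -> 0 <= Q i j.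
Hypothesis Qup : forall i : nat, 0 < Q i i.+1.
Hypothesis Qskip : forall i j : nat, (i.+1 < j)%N -> Q i j = 0.
Hypothesis Qrow : forall i : nat, \sum_(j < i.+2) Q i j = 0.
Hypothesis law : jump_law Q Y S.

Let Qdiag := generator_diag_lt0 Qoff Qup Qrow.

Lemma exponential_prob_le0 (q : R) : exponential_prob q `]-oo, 0] = 0%E.
Proof.
(* The density is zero only on the open half-line; the endpoint 0, where it equals [q], is dropped
   as a null set. *)
rewrite /exponential_prob -integral_itv_bndo_bndc; last first.
  apply: measurable_funTS; apply/measurable_EFinP.
  exact: measurable_exponential_pdf.
apply: integral0_eq => x /=; rewrite in_itv/= => x0.
by rewrite lt0_exponential_pdf.
Qed.

(* The law of the holding times is only given jointly with a prescribed path,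
   so the null set is a countable union over the initial segments of paths. *)
Lemma holding_time_gt0 : {ae P, forall w, forall k, 0 < S k w}.
Proof.
apply: ae_foralln => k.
pose B j : set R := if j == k then `]-oo, 0]%classic else setT.
have mB j : measurable (B j) by rewrite /B; case: ifP.
pose N (s : seq nat) :=
  [set w | (forall j, (j <= k.+1)%N -> Y j w = nth 0%N s j) /\
           (forall j, (j < k.+1)%N -> B j (S j w))].
have N0 s : P.-negligible (N s).
  exists (N s); split => //.
    apply: measurableI.
      exact: (measurable_jump_event Y
        (fun j => [set v | (j <= k.+1)%N -> v = nth 0%N s j])).
    rewrite [X in measurable X](_ : _ = \bigcap_(j in `I_k.+1) (S j @^-1` B j)).
      apply: bigcap_measurableType => j _; rewrite -[X in measurable X]setTI.
      exact: measurable_funPT.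
    by apply/seteqP; split => w /= H j; exact: H.
  rewrite (@law k.+1 (nth 0%N s) B)//.
  rewrite (bigD1 (ord_max : 'I_k.+1))//= /B eqxx exponential_prob_le0.
  by rewrite !mul0e mule0.
have : {ae P, forall w, forall i, ~ N (odflt [::] (unpickle i)) w}.
  apply: ae_foralln => i; have [A [mA PA NA]] := N0 (odflt [::] (unpickle i)).
  by exists A; split => // w /= /contrapT; exact: NA.
(* The law covers [S k] only with [k.+1] jumps prescribed, hence a segment of [k.+2] states. *)
apply: filterS => w /(_ (pickle (mkseq (Y^~ w) k.+2))); rewrite pickleK/= => NN.
rewrite ltNge; apply/negP => Sk; apply: NN; split => j jk.
  by rewrite nth_mkseq.
by rewrite /B; case: eqP => // ->; rewrite /= in_itv.
Qed.

Variable n : nat.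
Hypothesis n_gt0 : (0 < n)%N.
Hypothesis Y0 : {ae P, forall w, Y 0 w = 0%N}.

(** The first visit to [n] occurs at step [r.+1]: starting from 0 with [n > 0], at least one jump is
    made. *)
Let passage r := passage_event Y n 0 r (fun=> 0%N).

Let measurable_passage r : measurable (passage r).
Proof. exact: measurable_passage_event. Qed.

Let trivIset_passage : trivIset setT passage.
Proof.
have aux i j w : (i < j)%N -> passage i w -> passage j w -> False.
  move=> ij pi pj.
  have [_ _ /(_ erefl) Yi] := pi (1 + i)%N.
  have [_ + _] := pj (1 + i)%N.
  by rewrite Yi ltnn ltn_add2l ij => /(_ isT).
apply/trivIsetP => i j _ _; rewrite neq_ltn => ij.
by apply/seteqP; split => // w [pi pj]; case/orP: ij => /aux; exact.
Qed.

Lemma nneseries_discount_passage (d : nat -> R) : (forall i, 0 <= d i) ->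
  (\sum_(r <oo) \int[P]_(w in passage r) (discount Y S d r.+1 w)%:E =
   (total_passage Q d n 0)%:E)%E.
Proof.
move=> d0.
have PY0 : P [set w | Y 0%N w = 0%N] = 1%E.
  have m0 : measurable [set w | Y 0%N w = 0%N].
    rewrite (_ : mkset _ = Y 0%N @^-1` [set 0%N])// -[X in measurable X]setTI.
    exact: measurable_funP.
  rewrite -[X in P X]setCK probability_setC ?sube0; last exact: measurableC.
  rewrite (measure_negligible (measurableC m0)) ?sube0//.
apply/cvg_lim => //.
rewrite [X in X @ _ --> _](_ : _ =
    EFin \o (fun N => \sum_(r < N) first_passage Q d n r 0)).
  apply: cvg_EFin; first exact: nearW.
  exact: (cvg_sum_first_passage Qoff Qup Qskip Qrow d0 n_gt0).
apply/funext => N /=.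
rewrite big_mkord -sumEFin; apply: eq_bigr => r _.
rewrite (integral_discount_passage Qdiag Qoff law n 0 r (fun=> 0%N) d0).
by rewrite PY0 big_ord0 !mul1r.
Qed.

(* Without killing, the passage probabilities sum to [det (-Qn) / det (-Qn)]. *)
Lemma ae_passage : {ae P, forall w, exists r, passage r w}.
Proof.
have mU : measurable (\bigcup_r passage r) by exact: bigcup_measurable.
have PU : P (\bigcup_r passage r) = 1%E.
  rewrite measure_semi_bigcup//.
  (* For [d = 0] the [discount] is 1, so the series sums the probabilities of the disjoint events
     [passage r]. *)
  have := @nneseries_discount_passage (fun=> 0) (fun=> lexx 0).
  rewrite det_total_passage// (_ : diag_mx _ = 0) ?sub0r ?divff.
  - move=> <-; apply: eq_eseriesr => r _.
    rewrite -[in LHS](setIT (passage r)) -integral_indic//.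
    rewrite [RHS]integral_mkcond; apply: eq_integral => w _.
    rewrite patchE indicE; case: ifP => // _.
    by rewrite /discount big1 ?oppr0 ?expR0// => k _; rewrite mul0r.
  - exact: det_opp_generator_neq0.
  - by apply/matrixP => i j; rewrite !mxE mul0rn.
exists (~` \bigcup_r passage r); split.
- exact: measurableC.
- by rewrite [LHS]probability_setC// PU subee.
- by move=> w /= NU [r _ pr]; apply: NU; exists r.
Qed.

(** Almost surely exactly one [passage r] occurs, and there the integrand is [discount] at step
    [r.+1]. The integrand thus agrees almost everywhere with a series of restricted discounts, which
    is integrated termwise. No measurability of the occupation times is established, hence
    [ge0_eq_integral_ae]. *)
Lemma integral_expeR_occupation_time (X : R -> T -> nat) (d : nat -> R) :
  (forall i, 0 <= d i) ->
  {ae P, forall w, forall (k : nat) (t : R),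
    \sum_(i < k) S i w <= t < \sum_(i < k.+1) S i w -> X t w = Y k w} ->
  (\int[P]_w expeR (- \sum_(i < n) (d i)%:E * occupation_time X i n w) =
   (total_passage Q d n 0)%:E)%E.
Proof.
move=> d0 XY.
have f0 r w : (0 <= ((EFin \o discount Y S d r.+1) \_ (passage r)) w)%E.
  by apply: erestrict_ge0 => {}w _; rewrite lee_fin expR_ge0.
rewrite -nneseries_discount_passage//.
under [RHS]eq_eseriesr do rewrite integral_mkcond.
rewrite -integral_nneseries//; last first.
  move=> r; apply/(measurable_restrictT _ _).1 => //.
  by apply: measurable_funTS; apply/measurable_EFinP; exact: measurable_discount.
apply: ge0_eq_integral_ae.
- by move=> w; exact: expeR_ge0.
- by move=> w; exact: nneseries_ge0.
have := holding_time_gt0; move: XY ae_passage.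
apply: filterS3 => w XYw [r pr] Sw.
have Yn k : (k < r.+1)%N -> (Y k w < n)%N.
  have [Yk0 Ykn _] := pr k; case: k Yk0 Ykn => [->//|k] _ Ykn kr.
  by apply: Ykn; rewrite add1n.
rewrite (expeR_occupation_time (y := Y^~ w) (s := S^~ w)
  (m := r.+1))//; last first.
  by have [_ _] := pr r.+1; apply.
rewrite (nneseriesD1 (n := r))// eseries0 ?adde0.
  by rewrite patchE mem_set.
move=> j _ /= jr; rewrite patchE memNset// => pj.
by move/eqP: jr; apply; apply: trivIset_passage => //; exists w.
Qed.

End passage_law.

(** * Laplace transform of the occupation times *)

Theorem mainTheorem1 (R : realType) (disp : measure_display)
  (T : measurableType disp) (P : probability T R)
  (Q : nat -> nat -> R) (X : R -> T -> nat)
  (hQoff : forall i j : nat, i <> j -> 0 <= Q i j)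
  (hQup : forall i : nat, 0 < Q i i.+1)
  (hQskip : forall i j : nat, (i.+1 < j)%N -> Q i j = 0)
  (hQrow : forall i : nat, \sum_(j < i.+2) Q i j = 0)
  (hX : is_ctmc P Q X)
  (hX0 : {ae P, forall w, X 0 w = 0%N})
  (n : nat) (hn : (1 <= n)%N)
  (d : 'I_n -> R) (hd : forall i, 0 <= d i) :
  let Qn : 'M[R]_n := \matrix_(i < n, j < n) Q i j in
  let D : 'M[R]_n := diag_mx (\row_(i < n) d i) in
  (\int[P]_w expeR (- \sum_(i < n) (d i)%:E * occupation_time X i n w))%E =
  (\det (- Qn) / \det (D - Qn))%:E.
Proof.
move=> Qn D; have [_ [Y [S [law0 XY]]]] := hX.
have law : jump_law Q Y S by exact: law0.
(* As [S 0] is almost surely positive, time 0 lies in the first holding interval, so [Y 0] agrees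
   with [X 0]. *)
have Y0 : {ae P, forall w, Y 0%N w = 0%N}.
  have := holding_time_gt0 law; move: XY hX0.
  apply: filterS3 => w XYw X0 Sw.
  by rewrite -(XYw 0%N 0) ?X0// big_ord0 lexx big_ord_recl big_ord0 addr0 Sw.
(* The rates are extended by 0 to all states, since the passage series takes rates indexed by
   [nat]. *)
pose e k : R := oapp d 0 (insub k).
have e0 k : 0 <= e k by rewrite /e; case: insub => //=.
have eE (i : 'I_n) : e i = d i by rewrite /e valK.
under eq_integral do under eq_bigr do rewrite -eE.
rewrite (integral_expeR_occupation_time hQoff hQup hQskip hQrow law)//.
rewrite det_total_passage//; congr (_ / \det (diag_mx _ - _))%:E.
by apply/rowP => i; rewrite !mxE eE.
Qed.
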